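(* Let $n\ge 1$ and $k\ge 3$ be integers. There exists a constant $M>0$, depending only on $n$ and $k$, such that for every $f\in C([0,1])$ and every $0<t\le \frac12$, $$M\cdot \omega_2(f,t)\le \|f-S_{n,k}f\|_\infty .$$
   Context: $C([0,1])$ is the space of real-valued continuous functions on $[0,1]$ with the supremum norm $\|\cdot\|_\infty$. For integers $n,k>0$ put $x_j=j/n$ for $0\le j\le n$, $x_j=0$ for $-k\le j\le 0$ and $x_j=1$ for $n\le j\le n+k$. The normalized B-splines of degree $k$ are $$N_{j,k}(x)=(x_{j+k+1}-x_j)\,[x_j,\ldots,x_{j+k+1}](\cdot-x)_+^k,\qquad -k\le j\le n-1,$$ where $[\ldots]$ is the divided difference (in the Hermite sense for repeated knots), with values taken by right-continuity on $[0,1)$ and by left limits at $x=1$. The nodes are $\xi_{j,k}=\frac{x_{j+1}+\cdots+x_{j+k}}{k}$ for $-k\le j\le n-1$. The (uniform) Schoenberg operator is $$S_{n,k}f(x)=\sum_{j=-k}^{n-1} f(\xi_{j,k})N_{j,k}(x)\quad (0\le x<1),\qquad S_{n,k}f(1)=\lim_{y\nearrow 1}S_{n,k}f(y).$$ The second order modulus of smoothness is, for $f\in C([0,1])$ and $0<t\le\frac12$, $$\omega_2(f,t)=\sup_{0<h<t}\ \sup_{x\in[0,1-2h]}|f(x)-2f(x+h)+f(x+2h)|.$$ *)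

(* Defs.v *)
From mathcomp Require Import all_boot all_order all_algebra.
From mathcomp Require Import all_classical all_reals all_analysis.

Set Implicit Arguments.
Unset Strict Implicit.
Unset Printing Implicit Defensive.

Import Order.TTheory GRing.Theory Num.Theory numFieldNormedType.Exports.

Local Open Scope classical_set_scope.
Local Open Scope ring_scope.

(* Divided difference [x 0, ..., x m] g of a nondecreasing sequence of points,
   in the Hermite sense: since x is sorted, x 0 = x m means that all m + 1
   points coincide, and then the value is the Taylor coefficient
   g^(m)(x 0) / m!. *)
Fixpoint divided_difference (R : realType) (g : R -> R) (x : nat -> R)
    (m : nat) : R :=
  match m with
  | 0 => g (x 0%N)
  | m'.+1 =>
      if x 0%N == x m then derive1n m g (x 0%N) / m`!%:R
      else (divided_difference g (fun i => x i.+1) m'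
              - divided_difference g x m') / (x m - x 0%N)
  end.

Definition knot (R : realType) (n : nat) (j : int) : R :=
  if j <= 0 then 0 else if n%:Z <= j then 1 else j%:~R / n%:R.

(* The truncated power t |-> (t - x)_+^k; this form is correct only for
   k > 0, since 0 ^+ 0 = 1. *)
Definition truncated_power (R : realType) (k : nat) (x t : R) : R :=
  Num.max 0 (t - x) ^+ k.

(* The divided-difference formula for N_{j,k}(x). It is only meaningful for
   0 < x < 1: at x = 0 and x = 1 the truncated power need not be k times
   differentiable at the multiple knots. *)
Definition bspline_interior (R : realType) (n k : nat) (j : int) (x : R) : R :=
  (knot R n (j + k.+1%:Z) - knot R n j) *
  divided_difference (truncated_power k x) (fun i : nat => knot R n (j + i%:Z))
    k.+1.

(* N_{j,k} on [0, 1]: right limits on [0, 1), left limit at 1. *)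
Definition bspline (R : realType) (n k : nat) (j : int) (x : R) : R :=
  if x < 1 then lim (bspline_interior n k j y @[y --> x^'+])
  else lim (bspline_interior n k j y @[y --> x^'-]).

Definition schoenberg_node (R : realType) (n k : nat) (j : int) : R :=
  (\sum_(1 <= l < k.+1) knot R n (j + l%:Z)) / k%:R.

(* The index j = -k, ..., n - 1 is written i - k with 0 <= i < n + k. *)
Definition schoenberg_sum (R : realType) (n k : nat) (f : R -> R) (x : R) : R :=
  \sum_(0 <= i < n + k)
     f (schoenberg_node R n k (i%:Z - k%:Z)) * bspline n k (i%:Z - k%:Z) x.

Definition schoenberg (R : realType) (n k : nat) (f : R -> R) (x : R) : R :=
  if x < 1 then schoenberg_sum n k f x
  else lim (schoenberg_sum n k f y @[y --> x^'-]).

Definition sup_norm01 (R : realType) (g : R -> R) : R :=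
  sup [set `|g x| | x in `[0, 1]].

Definition omega2 (R : realType) (f : R -> R) (t : R) : R :=
  sup [set sup [set `|f x - 2 * f (x + h) + f (x + 2 * h)|
                 | x in `[0, 1 - 2 * h]]
       | h in `]0, t[].

(* Main.v *)
(* The operator S = S_{n,k} is positive and reproduces affine functions, both by
   Abel summation of divided differences, and on ]0, 1[ it sees f only through
   its values at the n + k nodes. Let F be f minus its affine interpolant at 0
   and 1, so F - S F = f - S f. At every x in ]0, 1[ two consecutive B-splines
   with distinct nodes are strictly positive, so for the parabola
   p(x) = x (1 - x) the number p(x) - S p(x), which is the variance of the
   nodes under the weights N_j(x), is strictly positive. Hence a large multiple
   of ||f - S f|| p is a barrier at the nodes: a discrete maximum principle
   bounds |F| there, hence on [0, 1], by a constant times ||f - S f||, and the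
   second differences of f and F agree. *)
Require Import Defs.
From mathcomp Require Import all_boot all_order all_algebra.
From mathcomp Require Import all_classical all_reals all_analysis.
From mathcomp Require Import zify ring lra.
Import Order.TTheory GRing.Theory Num.Theory numFieldNormedType.Exports.
Local Open Scope classical_set_scope.
Local Open Scope ring_scope.

Set Implicit Arguments.
Unset Strict Implicit.
Unset Printing Implicit Defensive.

(** * Divided differences of truncated powers *)

(* The divided difference of (. - x)_+^k over t j, ..., t (j + m), with its
   Hermite value written out. At a repeated knot equal to x that value is a
   convention, chosen so that the recurrences hold without exception. *)
Fixpoint tpow_dd (R : realFieldType) (t : nat -> R) (k : nat) (x : R)
    (m j : nat) : R :=
  if t j == t (j + m)%N then
    if x < t j then 'C(k, m)%:R * (t j - x) ^+ (k - m) else 0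
  else if m is m'.+1 then
    (tpow_dd t k x m' j.+1 - tpow_dd t k x m' j) / (t (j + m)%N - t j)
  else 0.

Section DividedDifferences.
Variables (R : realFieldType) (t : nat -> R) (x : R).
Hypothesis t_nd : forall i j : nat, (i <= j)%N -> t i <= t j.

Local Notation D k m j := (tpow_dd t k x m j).

Lemma tpow_ddE k m j : t j = t (j + m)%N ->
  D k m j = if x < t j then 'C(k, m)%:R * (t j - x) ^+ (k - m) else 0.
Proof. by case: m => [|m] /= <-; rewrite eqxx. Qed.

(** The division-free recurrence survives coinciding knots: then the left factor vanishes and the
    two Hermite values on the right are equal. *)
Lemma tpow_ddS k m j :
  (t (j + m.+1)%N - t j) * D k m.+1 j = D k m j.+1 - D k m j.
Proof.
have [tE|tN] := eqVneq (t j) (t (j + m.+1)%N); last first.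
  rewrite /= (negPf tN) mulrC divfK // subr_eq0 eq_sym //.
have H i : (j <= i <= j + m.+1)%N -> t i = t j.
  move=> /andP[ji im]; apply/le_anti; rewrite (t_nd ji) tE.
  by rewrite t_nd.
rewrite -tE subrr mul0r !tpow_ddE ?H ?subrr //; lia.
Qed.

(** Leibniz rule for the factor [. - x], whose divided differences of order above 1 vanish. At
    coinciding knots it becomes Pascal's rule. *)
Lemma tpow_dd_mull k m j :
  D k.+1 m.+1 j = (t j - x) * D k m.+1 j + D k m j.+1.
Proof.
elim: m j => [|m IH] j.
- have [tE|tN] := eqVneq (t j) (t (j + 1)%N).
+ rewrite !tpow_ddE ?addn0 // -(addn1 j) -tE.
  case: ifP => _; last by rewrite mulr0 addr0.
  rewrite !bin1 subn1 /= bin0 subn0 mul1r subn1.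
  by case: k => [|k] /=; rewrite ?expr0 ?exprS; lra.
+ have dN : t (j + 1)%N - t j != 0 by rewrite subr_eq0 eq_sym.
  apply: (mulfI dN); rewrite tpow_ddS mulrDr mulrCA tpow_ddS.
  rewrite !tpow_ddE ?addn0 // !bin0 !subn0 !mul1r !addn1 !exprS.
  by do 2 case: ifP => _; ring.
- have [tE|tN] := eqVneq (t j) (t (j + m.+2)%N).
+ have H i : (j <= i <= j + m.+2)%N -> t i = t j.
    move=> /andP[ji im]; apply/le_anti; rewrite (t_nd ji) tE.
    by rewrite t_nd.
  rewrite !tpow_ddE ?H //; try lia.
  case: ifP => _; last by rewrite mulr0 addr0.
  rewrite binS natrD subSS mulrDl; congr (_ + _).
  have [km|mk] := ltnP k m.+2; first by rewrite bin_small // !mul0r mulr0.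
  by rewrite -(subnSK mk) exprS; ring.
+ have dN : t (j + m.+2)%N - t j != 0 by rewrite subr_eq0 eq_sym.
  apply: (mulfI dN); rewrite tpow_ddS !IH mulrDr mulrCA tpow_ddS.
  have := tpow_ddS k m j.+1; rewrite addSnnS => E.
  suff : D k m j.+2 - D k m j.+1 = (t (j + m.+2)%N - t j.+1) * D k m.+1 j.+1.
    by move/eqP; rewrite subr_eq => /eqP ->; ring.
  by rewrite E.
Qed.

Lemma tpow_dd_eq0_right k m j : t (j + m)%N <= x -> D k m j = 0.
Proof.
elim: m j => [|m IH] j le_x.
  by rewrite tpow_ddE ?addn0 // ltNge -[in t j](addn0 j) le_x.
have le_jx : t j <= x by apply: le_trans le_x; apply: t_nd; lia.
have [tE|tN] := eqVneq (t j) (t (j + m.+1)%N).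
  by rewrite tpow_ddE // ltNge le_jx.
rewrite /= (negPf tN) !IH ?subrr ?mul0r //.
  by apply: le_trans le_x; apply: t_nd; lia.
by rewrite addSnnS.
Qed.

(** All the knots lie beyond [x], where the truncated power is a polynomial of degree [k], and a
    difference of higher order kills it. *)
Lemma tpow_dd_eq0_left k m j : x < t j -> (k < m)%N -> D k m j = 0.
Proof.
elim: k m j => [|k IH] m j xt; last first.
  case: m => // m km; rewrite tpow_dd_mull (IH m.+1) ?(IH m) ?mulr0 ?addr0 //.
    exact: lt_le_trans xt (t_nd (leqnSn _)).
  exact: ltnW.
elim: m j xt => // m IHm j xt _.
have xt' : x < t j.+1 by apply: lt_le_trans xt _; apply: t_nd; lia.
have [tE|tN] := eqVneq (t j) (t (j + m.+1)%N).
  by rewrite tpow_ddE // bin_small // mul0r if_same.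
rewrite /= (negPf tN).
case: m IHm {tN} => [|m] IHm.
  by rewrite !tpow_ddE ?addn0 // xt xt' subrr mul0r.
by rewrite !IHm ?subrr ?mul0r.
Qed.

(** The Cox-de Boor recurrence: [tpow_ddS] lowers the order, then [tpow_dd_mull] lowers the
    exponent. *)
Lemma tpow_dd_rec k j :
  (t (j + k.+2)%N - t j) * D k.+1 k.+2 j =
  (t (j + k.+2)%N - x) * D k k.+1 j.+1 + (x - t j) * D k k.+1 j.
Proof.
rewrite tpow_ddS !tpow_dd_mull.
have := tpow_ddS k k j.+1; rewrite addSnnS.
move=> /eqP; rewrite eq_sym subr_eq => /eqP ->; ring.
Qed.

(** Outside the support the value is 0; inside it both weights of the Cox-de Boor recurrence are
    nonnegative. *)
Lemma tpow_dd_ge0 k j : 0 <= D k k.+1 j.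
Proof.
have [xt|tx] := ltP x (t j); first by rewrite tpow_dd_eq0_left.
have [xt|xt] := leP (t (j + k.+1)%N) x; first by rewrite tpow_dd_eq0_right.
have dpos : 0 < t (j + k.+1)%N - t j by rewrite subr_gt0 (le_lt_trans tx).
elim: k j tx xt dpos => [|k IH] j tx xt dpos.
  rewrite -(pmulr_rge0 _ dpos) tpow_ddS !tpow_ddE ?addn0 // -addn1 xt.
  by rewrite ltNge tx /= subr0 bin0 mul1r.
have nn i : 0 <= D k k.+1 i.
  have [ti|ti] := ltP x (t i); first by rewrite tpow_dd_eq0_left.
  have [it|it] := leP (t (i + k.+1)%N) x; first by rewrite tpow_dd_eq0_right.
  by apply: IH => //; rewrite subr_gt0 (le_lt_trans ti).
rewrite -(pmulr_rge0 _ dpos) tpow_dd_rec addr_ge0 // mulr_ge0 //.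
  by rewrite subr_ge0 ltW.
by rewrite subr_ge0.
Qed.

Lemma tpow_dd_gt0 k j : (forall i, t i.+1 <= x -> t i < x) ->
  t j < x -> x < t (j + k.+1)%N -> 0 < D k k.+1 j.
Proof.
move=> simple tjx.
(* At exponent 0 the induction must allow [t j = x]: passing to [j.+1] can land on a simple knot
   equal to [x], where the step function is still positive. *)
have {tjx} : t j <= x /\ ((0 < k)%N -> t j < x) by split=> //; apply: ltW.
elim: k j => [|k IH] j [tx tx'] xt.
  have dpos : 0 < t (j + 1)%N - t j by rewrite subr_gt0 (le_lt_trans tx).
  rewrite -(pmulr_rgt0 _ dpos) tpow_ddS !tpow_ddE ?addn0 // -addn1 xt.
  by rewrite (ltNge x) tx /= subr0 bin0 mul1r expr0.
have dpos : 0 < t (j + k.+2)%N - t j by rewrite subr_gt0 (le_lt_trans tx).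
have {}tx' := tx' isT.
rewrite -(pmulr_rgt0 _ dpos) tpow_dd_rec.
have [xt1|xt1] := ltP x (t (j + k.+1)%N).
  apply: ltr_wpDl; first by rewrite mulr_ge0 ?tpow_dd_ge0 // subr_ge0 ltW.
  by rewrite mulr_gt0 ?subr_gt0 ?IH.
apply: ltr_wpDr; first by rewrite mulr_ge0 ?tpow_dd_ge0 // subr_ge0.
rewrite mulr_gt0 ?subr_gt0 // IH ?addSnnS //.
split=> [|k0]; first by apply: le_trans xt1; apply: t_nd; lia.
by apply: simple; apply: le_trans xt1; apply: t_nd; lia.
Qed.

End DividedDifferences.

(** * Partition of unity and nodes for knots clamped at 0 and 1 *)

Section OpenKnots.
Variables (R : realFieldType) (t : nat -> R) (n k : nat).

Definition greville (i : nat) : R := (\sum_(1 <= l < k.+1) t (i + l)%N) / k%:R.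

Local Notation S i := (\sum_(1 <= l < k.+1) t (i + l)%N).

Lemma knot_sumS i : S i.+1 - S i = t (i + k.+1)%N - t i.+1.
Proof.
rewrite -sumrB -[in t i.+1](addn1 i).
by apply: (telescope_sumr_eq (fun l => t (i + l)%N)) => // l _; rewrite addSnnS.
Qed.

Lemma greville_lt i : (0 < k)%N -> t i.+1 < t (i + k.+1)%N ->
  greville i < greville i.+1.
Proof.
move=> k0 tlt; rewrite /greville ltr_pM2r ?invr_gt0 ?ltr0n //.
by rewrite -subr_gt0 knot_sumS subr_gt0.
Qed.

Hypothesis t_nd : forall i j : nat, (i <= j)%N -> t i <= t j.
Hypothesis t0 : forall i : nat, (i <= k)%N -> t i = 0.
Hypothesis t1 : forall i : nat, (n + k <= i)%N -> t i = 1.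

Lemma greville_bounds i : (0 < k)%N -> 0 <= greville i <= 1.
Proof.
move=> k0; have kR : 0 < k%:R :> R by rewrite ltr0n.
have t01 l : 0 <= t l <= 1.
  by rewrite -{1}(t0 (leq0n k)) -(t1 (leq_addr l (n + k))) !t_nd //; lia.
rewrite /greville divr_ge0 ?ler0n ?sumr_ge0 //=; last first.
  by move=> l _; case/andP: (t01 (i + l)%N).
rewrite ler_pdivrMr // mul1r.
apply: (@le_trans _ _ (\sum_(1 <= l < k.+1) 1)).
  by apply: ler_sum => l _; case/andP: (t01 (i + l)%N).
by rewrite sumr_const_nat subn1.
Qed.

Variable x : R.
Hypothesis x01 : 0 < x < 1.

Local Notation D m j := (tpow_dd t k x m j).
Local Notation B i := ((t (i + k.+1)%N - t i) * D k.+1 i).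

Lemma tpow_dd0 m j : (j + m <= k)%N -> D m j = 0.
Proof.
move=> jm; have [x0 _] := andP x01.
by rewrite tpow_ddE ?t0 // ?ltNge ?ltW //; lia.
Qed.

Lemma tpow_dd1 m j : (n + k <= j)%N -> D m j = 'C(k, m)%:R * (1 - x) ^+ (k - m).
Proof.
move=> jn; have [_ x1] := andP x01.
by rewrite tpow_ddE ?t1 ?x1 //; lia.
Qed.

(** By [tpow_ddS] each term is a difference of order-[k] values; the sum telescopes from 0 at the
    knots 0 to ['C(k, k)] at the knots 1. *)
Lemma bspline_sum1 : \sum_(0 <= i < n + k) B i = 1.
Proof.
under eq_bigr do rewrite tpow_ddS //.
rewrite telescope_sumr // (tpow_dd0 (j := 0)) // tpow_dd1 //.
by rewrite binn subnn mulr1 subr0.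
Qed.

(** Abel summation: the increment of the knot sums is exactly the factor that turns [D k i.+1] into
    a difference of order [k.-1], so [S i * D k i - D k.-1 i.+1] is a primitive. Its value at the
    upper end is [k - k (1 - x)]. *)
Lemma bspline_sum_greville : (0 < k)%N ->
  \sum_(0 <= i < n + k) greville i * B i = x.
Proof.
move=> k0; have kR : k%:R != 0 :> R by rewrite pnatr_eq0 -lt0n.
apply: (mulfI kR); rewrite mulr_sumr.
rewrite (telescope_sumr_eq (fun i => S i * D k i - D k.-1 i.+1)) //; last first.
  move=> i _; rewrite /greville [LHS]mulrA [k%:R * _]mulrC divfK //.
  rewrite tpow_ddS //.
  have := tpow_ddS x t_nd k k.-1 i.+1; rewrite prednK // addSnnS -knot_sumS.
  by move=> /eqP; rewrite -subr_eq0 => /eqP; lra.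
rewrite (tpow_dd0 (j := 0)) // (tpow_dd0 (j := 1)) ?add1n ?prednK //.
rewrite !tpow_dd1 //.
have -> : S (n + k)%N = k%:R.
  rewrite (eq_bigr (fun=> 1)) ?sumr_const_nat ?subn1 // => l _.
  by rewrite t1 // leq_addr.
have -> : 'C(k, k.-1) = k by rewrite -bin_sub ?leq_pred // -subn1 subKn // bin1.
have -> : (k - k.-1 = 1)%N by lia.
by rewrite binn subnn; ring.
Qed.

Lemma ex_adjacent_bsplines : (2 < k)%N ->
  (forall i, t i = t i.+1 -> t i = 0 \/ t i = 1) ->
  exists2 j : nat, (j.+1 < n + k)%N &
    [/\ 0 < B j, 0 < B j.+1 & greville j < greville j.+1].
Proof.
have [x0 x1] := andP x01.
move=> k2 t_simple.
have simple i : t i.+1 <= x -> t i < x.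
  move=> tx; rewrite lt_neqAle (le_trans (t_nd (leqnSn i))) // andbT.
  apply/eqP => tix; have tE : t i = t i.+1.
    by apply/le_anti; rewrite t_nd //= tix.
  by case: (t_simple _ tE) => E; move: x0 x1; rewrite -tix E ltxx.
have ex : exists l, x < t l by exists (n + k)%N; rewrite t1.
case: (ex_minnP ex) => L xL Lmin.
have Ln : (L <= n + k)%N by apply: Lmin; rewrite t1.
have kL : (k < L)%N.
  by rewrite ltnNge; apply/negP => /t0 E; rewrite E ltNge ltW in xL.
have tL : t L.-1 <= x by rewrite leNgt; apply/negP => /Lmin; lia.
have tj i : (i < L.-1)%N -> t i < x.
  by move=> iL; apply: simple; apply: le_trans tL; apply: t_nd.
have jt i : (L <= i)%N -> x < t i by move=> Li; apply: lt_le_trans xL (t_nd Li).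
have Bpos i : (i < L.-1 <= i + k)%N -> 0 < B i.
  move=> /andP[iL Li]; have ti := tj _ iL.
  have it : x < t (i + k.+1)%N by apply: jt; lia.
  rewrite mulr_gt0 ?subr_gt0 ?(lt_trans ti) //.
  exact: tpow_dd_gt0.
(* With [t L.-1 <= x < t L], the index [L - 2] is the last whose knot is surely strictly left of
   [x], since [x] may equal [t L.-1]. It and [L - 3] have [x] inside their supports. *)
exists (L - 3)%N; first lia.
split; [apply: Bpos; lia|apply: Bpos; lia|].
apply: greville_lt; first lia.
by apply: (@lt_trans _ _ x); [apply: tj|apply: jt]; lia.
Qed.

End OpenKnots.

(** * B-splines on uniform knots *)

Section Knots.
Variables (R : realType) (n k : nat).

(** The shift sends the first index [-k] to 0, giving a sequence over [nat] to which [tpow_dd]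
    applies. *)
Definition shifted_knot (i : nat) : R := knot R n (i%:Z - k%:Z).

Lemma shifted_knot0 i : (i <= k)%N -> shifted_knot i = 0.
Proof. by move=> ik; rewrite /shifted_knot /knot ifT //; lia. Qed.

Hypothesis n0 : (0 < n)%N.

Lemma shifted_knot1 i : (n + k <= i)%N -> shifted_knot i = 1.
Proof. by move=> ik; rewrite /shifted_knot /knot ifF 1?ifT //; lia. Qed.

Lemma shifted_knot_mid i : (k <= i <= n + k)%N ->
  shifted_knot i = (i - k)%:R / n%:R.
Proof.
move=> /andP[ki ik]; have [->|kNi] := eqVneq i k.
  by rewrite shifted_knot0 // subnn mul0r.
have [->|nNi] := eqVneq i (n + k)%N.
  by rewrite shifted_knot1 // addnK divff // pnatr_eq0 -lt0n.
rewrite /shifted_knot /knot !ifF; try lia.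
by rewrite subzn.
Qed.

Lemma shifted_knotS i : (k <= i < n + k)%N ->
  shifted_knot i < shifted_knot i.+1.
Proof.
move=> ik; rewrite !shifted_knot_mid; try lia.
by rewrite ltr_pM2r ?invr_gt0 ?ltr0n // ltr_nat; lia.
Qed.

Lemma shifted_knot_nd i j : (i <= j)%N -> shifted_knot i <= shifted_knot j.
Proof.
move: i j; apply: (homo_leq (r := fun a b : R => a <= b)) => // [y x z|i].
  exact: le_trans.
have [ik|ki] := ltnP i k; first by rewrite !shifted_knot0 // ltnW.
have [nki|ink] := leqP (n + k) i; first by rewrite !shifted_knot1 // leqW.
by rewrite ltW // shifted_knotS // ki.
Qed.

Lemma shifted_knot_simple i : shifted_knot i = shifted_knot i.+1 ->
  shifted_knot i = 0 \/ shifted_knot i = 1.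
Proof.
have [ik|ki] := ltnP i k; first by rewrite !shifted_knot0 //; [left|apply: ltnW].
have [nki|ink] := leqP (n + k) i.
  by rewrite !shifted_knot1 //; [right|apply: leqW].
by move=> E; have := @shifted_knotS i; rewrite E ltxx ki ink => /(_ isT).
Qed.
End Knots.

(** * Truncated powers: derivatives, Hermite values, continuity *)

Section TruncatedPower.
Variables (R : realType) (k : nat).
Hypothesis k0 : (0 < k)%N.

Lemma truncated_powerE (x a : R) :
  truncated_power k x a = if x < a then (a - x) ^+ k else 0.
Proof.
rewrite /truncated_power maxEle subr_ge0 le_eqVlt.
have [->|xa] /= := eqVneq x a; first by rewrite subrr ltxx expr0n gtn_eqF.
by case: ifP => // _; rewrite expr0n gtn_eqF.
Qed.

(** Away from [x] the truncated power agrees locally with a polynomial or with 0, and the induction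
    differentiates that local formula. *)
Lemma derive1n_truncated_power m (x a : R) : a != x ->
  derive1n m (truncated_power k x) a =
    if x < a then (k ^_ m)%:R * (a - x) ^+ (k - m) else 0.
Proof.
elim: m a => [|m IH] a ax.
  by rewrite derive1n0 truncated_powerE ffactn0 subn0 mul1r.
rewrite derive1nS derive1E.
have [xa|xa] := ltP x a.
  pose g : R -> R := (k ^_ m)%:R *: ((id - cst x) ^+ (k - m)).
  have gE b : g b = (k ^_ m)%:R * (b - x) ^+ (k - m).
    by rewrite /g !fctE.
  have E : \near a, derive1n m (truncated_power k x) a = g a.
    near=> b; have xb : x < b by near: b; exact: lt_nbhsr.
    by rewrite IH ?xb ?gE // gt_eqF.
  have dg : is_derive a 1 g
      ((k ^_ m)%:R *: (((k - m)%:R * (a - x) ^+ (k - m).-1) *: (1 - 0))).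
    by apply: is_deriveZ; apply: is_deriveX; apply: is_deriveB.
  rewrite (near_eq_derive _ E) derive_val subr0 ffactnSr natrM subnS.
  by rewrite scaler1 -mulrA.
have {xa}ax' : a < x by rewrite lt_neqAle ax.
have E : \near a, derive1n m (truncated_power k x) a = cst 0 a.
  near=> b; have bx : b < x by near: b; exact: lt_nbhsl.
  by rewrite IH ?lt_eqF // ltNge ltW.
by rewrite (near_eq_derive _ E) derive_cst.
Unshelve. all: by end_near.
Qed.

(** Repeated knots avoid [x], so derivatives are taken only where the truncated power is smooth, and
    [k ^_ m / m!] is the binomial of [tpow_dd]. *)
Lemma divided_difference_truncated_power (s : nat -> R) (x : R) m j :
  {homo s : i j / (i <= j)%N >-> i <= j} ->
  (forall i, s i = s i.+1 -> s i != x) ->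
  divided_difference (truncated_power k x) (fun i => s (j + i)%N) m =
  tpow_dd s k x m j.
Proof.
move=> s_nd s_simple; elim: m j => [|m IH] j.
  by rewrite /= addn0 eqxx truncated_powerE bin0 subn0 mul1r.
rewrite /= addn0; case: eqP => [sE|_].
  rewrite -derive1nS derive1n_truncated_power; last first.
    apply: s_simple; apply/le_anti; rewrite s_nd //= sE s_nd //; lia.
  case: ifP => _; last by rewrite mul0r.
  by rewrite mulrAC -bin_ffact natrM mulfK // pnatr_eq0 -lt0n fact_gt0.
rewrite -!IH; congr ((divided_difference _ _ _ - _) / _).
by apply/funext => i; rewrite addSnnS.
Qed.

(** The Hermite branch can jump only when [y] crosses a repeated knot, and none of these equals
    [x]. *)
Lemma continuous_tpow_dd (s : nat -> R) (x : R) m j :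
  {homo s : i j / (i <= j)%N >-> i <= j} ->
  (forall i, s i = s i.+1 -> s i != x) ->
  {for x, continuous (fun y => tpow_dd s k y m j)}.
Proof.
move=> s_nd s_simple; elim: m j => [|m IH] j.
  have -> : (fun y => tpow_dd s k y 0 j) = (fun y => Num.max 0 (s j - y) ^+ k).
    apply/funext => y; rewrite -/(truncated_power k y (s j)) truncated_powerE.
    by rewrite /= addn0 eqxx bin0 subn0 mul1r.
  apply: (@continuous_comp _ _ _
      (fun y => Num.max 0 (s j - y)) (fun z => z ^+ k));
    last exact: exprn_continuous.
  apply: (@continuous_max _ _ (cst 0) (fun y => s j - y)).
    exact: cst_continuous.
  by apply: continuousB; [exact: cst_continuous|exact: cvg_id].
rewrite /=; case: eqP => [sE|_]; last first.
  apply: continuousM; last exact: cst_continuous.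
  by apply: continuousB.
have sx : s j != x.
  apply: s_simple; apply/le_anti; rewrite s_nd //= sE s_nd //; lia.
have cp : {for x, continuous
    (fun y => 'C(k, m.+1)%:R * (s j - y) ^+ (k - m.+1))}.
  apply: continuousM; first exact: cst_continuous.
  apply: (@continuous_comp _ _ _ (fun y => s j - y) (fun z => z ^+ _));
    last exact: exprn_continuous.
  by apply: continuousB; [exact: cst_continuous|exact: cvg_id].
have [xs|xs] := ltP x (s j).
  rewrite /prop_for /continuous_at xs; apply: cvg_trans cp.
  apply: near_eq_cvg; near=> y.
  by rewrite ifT //; near: y; exact: lt_nbhsl.
rewrite /prop_for /continuous_at ltNge xs /=.
apply: cvg_near_cst; near=> y.
rewrite ifF //; apply/negbTE; rewrite -leNgt ltW //; near: y; apply: lt_nbhsr.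
by rewrite lt_neqAle sx.
Unshelve. all: by end_near.
Qed.
End TruncatedPower.

Section BsplineInterior.
Variables (R : realType) (n k : nat).
Local Notation t := (@shifted_knot R n k).

Lemma schoenberg_nodeE i :
  schoenberg_node R n k (i%:Z - k%:Z) = greville t k i.
Proof.
rewrite /schoenberg_node /greville; congr (_ / _).
by apply: eq_bigr => l _; rewrite /shifted_knot; congr knot; lia.
Qed.

Hypotheses (n0 : (0 < n)%N) (k0 : (0 < k)%N).

(** The only repeated knots are 0 and 1, so on ]0, 1[ the interior formula is continuous and the
    right limit in [bspline] is its value. *)
Lemma bsplineE i (x : R) : 0 < x < 1 ->
  bspline n k (i%:Z - k%:Z) x =
  (t (i + k.+1)%N - t i) * tpow_dd t k x k.+1 i.
Proof.
have simple y : 0 < y < 1 -> forall j, t j = t j.+1 -> t j != y.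
  move=> /andP[y0 y1] j /(shifted_knot_simple n0)[] E; rewrite E.
    by rewrite lt_eqF.
  by rewrite gt_eqF.
have shift j : knot R n (i%:Z - k%:Z + j%:Z) = t (i + j)%N.
  by rewrite /shifted_knot; congr knot; lia.
have inner y : 0 < y < 1 -> bspline_interior n k (i%:Z - k%:Z) y =
    (t (i + k.+1)%N - t i) * tpow_dd t k y k.+1 i.
  move=> y01; rewrite /bspline_interior shift; congr (_ * _).
  rewrite -divided_difference_truncated_power //.
  - by congr divided_difference; apply/funext => j; rewrite shift.
  - exact: shifted_knot_nd.
  - exact: simple.
move=> x01; have [x0 x1] := andP x01.
rewrite /bspline x1; apply: cvg_lim => //.
apply: cvg_at_right_filter.
have c : {for x, continuous
    (fun y => (t (i + k.+1)%N - t i) * tpow_dd t k y k.+1 i)}.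
  apply: continuousM; first exact: cst_continuous.
  apply: continuous_tpow_dd => //; [exact: shifted_knot_nd|exact: simple].
apply: cvg_trans c; apply: near_eq_cvg; near=> y.
rewrite inner //; apply/andP; split; near: y.
- exact: lt_nbhsr.
- exact: lt_nbhsl.
Unshelve. all: by end_near.
Qed.

End BsplineInterior.

(** * The maximum principle *)

(** Discrete maximum principle: an average cannot exceed the maximum of [u], so a maximizer must be
    a boundary index. *)
Lemma le0_of_lt_average (R : realFieldType) (I : finType) (bd : pred I)
    (A : I -> I -> R) (u : I -> R) :
  (forall i j, ~~ bd i -> 0 <= A i j) ->
  (forall i, ~~ bd i -> \sum_j A i j = 1) ->
  (forall i, bd i -> u i <= 0) ->
  (forall i, ~~ bd i -> u i < \sum_j A i j * u j) ->
  forall i, u i <= 0.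
Proof.
move=> A0 A1 u0 u_lt i; case: (@arg_maxP _ _ _ i predT u isT) => m _ umax.
apply: le_trans (umax i isT) _; have [/u0//|bdm] := boolP (bd m).
have := u_lt m bdm; rewrite ltNge => /negP[].
rewrite -[leRHS]mul1r -(A1 m bdm) mulr_suml.
by apply: ler_sum => j _; rewrite ler_wpM2l ?A0 //; apply: umax.
Qed.

Section PositiveOperator.
Variables (R : realFieldType) (I : finType) (X : I -> R) (B : I -> R -> R).
Hypothesis X01 : forall i, 0 <= X i <= 1.
Hypothesis B_ge0 : forall i x, 0 < x < 1 -> 0 <= B i x.
Hypothesis B_sum1 : forall x, 0 < x < 1 -> \sum_i B i x = 1.
Hypothesis B_sumX : forall x, 0 < x < 1 -> \sum_i X i * B i x = x.
Hypothesis B_spread : forall x, 0 < x < 1 -> exists2 i, 0 < B i x & X i != x.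

Let var x := \sum_j B j x * (X j - x) ^+ 2.

Lemma sum_parabola x : 0 < x < 1 ->
  \sum_j B j x * (X j * (1 - X j)) = x * (1 - x) - var x.
Proof.
move=> x01.
rewrite (eq_bigr (fun j => (1 - 2 * x) * (X j * B j x) + x ^+ 2 * B j x -
    B j x * (X j - x) ^+ 2)); last by move=> j _; ring.
by rewrite sumrB big_split /= -!mulr_sumr B_sumX // B_sum1 // /var; ring.
Qed.

Lemma var_gt0 x : 0 < x < 1 -> 0 < var x.
Proof.
move=> x01; have [i Bi Xi] := B_spread x01.
rewrite /var (bigD1 i) //=; apply: ltr_pwDl.
  by rewrite mulr_gt0 // exprn_even_gt0 // subr_eq0.
by apply: sumr_ge0 => j _; rewrite mulr_ge0 ?B_ge0 ?sqr_ge0.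
Qed.

Lemma norm_le_defect : exists2 c : R, 0 < c &
  forall (F : R -> R) (G : R), F 0 = 0 -> F 1 = 0 ->
    (forall x, 0 < x < 1 -> `|F x - \sum_i F (X i) * B i x| < G) ->
    forall x, 0 <= x <= 1 -> `|F x| <= c * G.
Proof.
(* The sum [C] of these dominates each reciprocal variance, which gives [C * var >= 1] at every
   interior node; nodes at 0 and 1, of no use there, contribute 0. *)
pose d i := if 0 < X i < 1 then (var (X i))^-1 else 0.
have d0 i : 0 <= d i.
  by rewrite /d; case: ifP => // ?; rewrite invr_ge0 ltW ?var_gt0.
pose C := \sum_i d i.
have C0 : 0 <= C by apply: sumr_ge0 => i _.
have CV i : 0 < X i < 1 -> 1 <= C * var (X i).
  move=> Xi; rewrite -(@mulVf _ (var (X i))) ?gt_eqF ?var_gt0 //.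
  rewrite ler_wpM2r ?(ltW (var_gt0 Xi)) // /C (bigD1 i) //= {1}/d Xi.
  by rewrite lerDl sumr_ge0.
exists (1 + C) => [|F G F0 F1 FG]; first by rewrite ltr_pwDl.
have G0 : 0 < G.
  apply: le_lt_trans (FG (1 / 2) _) => //; apply/andP; split; lra.
have edge x : 0 <= x <= 1 -> ~~ (0 < x < 1) -> F x = 0 /\ x * (1 - x) = 0.
  move=> x01 xN; suff [->|->] : x = 0 \/ x = 1.
  - by rewrite mul0r.
  - by rewrite subrr mulr0.
  have [|x0] := boolP (x == 0); first by left; apply/eqP.
  have [|x1] := boolP (x == 1); first by right; apply/eqP.
  by move: xN x01; rewrite !lt_neqAle x1 eq_sym x0 => /negP H /H.
(* Barrier: [s * F] minus a multiple of the parabola, for a sign [s]. *)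
have node s : `|s| = 1 -> forall i, s * F (X i) - C * G * (X i * (1 - X i)) <= 0.
  move=> s1.
  apply: (@le0_of_lt_average _ _ (fun i => ~~ (0 < X i < 1))
    (fun i j => B j (X i))).
  - by move=> i j /negPn Xi; apply: B_ge0.
  - by move=> i /negPn Xi; apply: B_sum1.
  - by move=> i /(edge _ (X01 i))[-> ->]; rewrite !mulr0 subr0.
  move=> i /negPn Xi.
  rewrite (eq_bigr (fun j => s * (F (X j) * B j (X i)) -
      C * G * (B j (X i) * (X j * (1 - X j))))); last by move=> j _; ring.
  rewrite sumrB -!mulr_sumr sum_parabola // -subr_gt0.
  set T := \sum_j _.
  have lt1 : s * (F (X i) - T) < G.
    apply: le_lt_trans (FG _ Xi); rewrite (le_trans (ler_norm _)) //.
    by rewrite normrM s1 mul1r.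
  (* The averaged parabola falls short by [var], so it remains to see that
     [s * (F (X i) - T) < C * G * var (X i)]. *)
  have : G * 1 <= G * (C * var (X i)) by rewrite ler_pM2l // CV.
  by lra.
have F_node i : `|F (X i)| <= C * G.
  have H : C * G * (X i * (1 - X i)) <= C * G.
    have [X0 X1] := andP (X01 i).
    rewrite ler_piMr ?mulr_ge0 ?(ltW G0) //.
    by rewrite mulr_ile1 ?subr_ge0 // gerBl.
  have := node 1 (normr1 _) i; have := node (-1) (normrN1 _) i.
  by move=> H1 H2; rewrite ler_norml; apply/andP; split; lra.
move=> x x01; have [xi|/(edge _ x01)[-> _]] := boolP (0 < x < 1); last first.
  by rewrite normr0 mulr_ge0 ?addr_ge0 // ltW.
(* Of the constant [1 + C], the 1 pays for the defect and [C] for the weighted mean of the node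
   values. *)
rewrite -(subrK (\sum_i F (X i) * B i x) (F x)) mulrDl mul1r.
apply: le_trans (ler_normD _ _) _; apply: lerD; first exact/ltW/FG.
apply: le_trans (ler_norm_sum _ _ _) _.
rewrite -[leRHS]mulr1 -(B_sum1 xi) mulr_sumr.
apply: ler_sum => i _; rewrite normrM (ger0_norm (B_ge0 _ xi)).
by rewrite ler_wpM2r ?B_ge0.
Qed.
End PositiveOperator.

(** * The Schoenberg operator *)

Section Schoenberg.
Variables (R : realType) (n k : nat).
Hypotheses (n0 : (0 < n)%N) (k2 : (2 < k)%N).
Local Notation t := (@shifted_knot R n k).
Let X (i : 'I_(n + k)) := schoenberg_node R n k (i%:Z - k%:Z).
Let B (i : 'I_(n + k)) (x : R) := bspline n k (i%:Z - k%:Z) x.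
Let k0 : (0 < k)%N. Proof. by lia. Qed.
Let t_nd := @shifted_knot_nd R n k n0.
Let t0 := @shifted_knot0 R n k.
Let t1 := @shifted_knot1 R n k n0.

Lemma schoenberg_node01 i : 0 <= X i <= 1.
Proof. by rewrite /X schoenberg_nodeE; apply: (greville_bounds t_nd t0 t1). Qed.

Lemma bspline_ge0 i x : 0 < x < 1 -> 0 <= B i x.
Proof.
move=> x01; rewrite /B bsplineE // mulr_ge0 //.
  by rewrite subr_ge0 t_nd // leq_addr.
exact: tpow_dd_ge0.
Qed.

Lemma bspline_partition x : 0 < x < 1 -> \sum_i B i x = 1.
Proof.
move=> x01; rewrite -(bspline_sum1 t_nd t0 t1 x01) big_mkord.
by apply: eq_bigr => i _; rewrite /B bsplineE.
Qed.

Lemma bspline_reproduces_id x : 0 < x < 1 -> \sum_i X i * B i x = x.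
Proof.
move=> x01; rewrite -[RHS](bspline_sum_greville t_nd t0 t1 x01) // big_mkord.
by apply: eq_bigr => i _; rewrite /B bsplineE // /X schoenberg_nodeE.
Qed.

(** Of two distinct nodes carrying positive weight, at least one differs from [x]. *)
Lemma bspline_spread x : 0 < x < 1 -> exists2 i, 0 < B i x & X i != x.
Proof.
move=> x01.
have [//|j jn [Bj Bj1 lt_j]] := ex_adjacent_bsplines t_nd t0 t1 x01 k2.
  exact: shifted_knot_simple.
have [E|Nx] := eqVneq (greville t k j) x.
  exists (Ordinal jn); first by rewrite /B bsplineE.
  by rewrite /X schoenberg_nodeE gt_eqF // -E.
exists (Ordinal (ltnW jn)); first by rewrite /B bsplineE.
by rewrite /X schoenberg_nodeE.
Qed.

Lemma schoenbergE (f : R -> R) x : x < 1 ->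
  schoenberg n k f x = \sum_i f (X i) * B i x.
Proof. by move=> x1; rewrite /schoenberg x1 /schoenberg_sum big_mkord. Qed.

(** Makes [sup_norm01] a true upper bound, since [sup] of an unbounded set is 0 by default. The
    values of the operator at 0 and 1 enter the bound as they stand, the weights being controlled
    only on ]0, 1[. *)
Lemma schoenberg_defect_bounded (f : R -> R) :
  {within `[0, 1], continuous f} ->
  has_ubound [set `|f x - schoenberg n k f x| | x in `[0, 1]].
Proof.
move=> f_cont.
have nf_cont : {within `[0, 1], continuous (fun x => `|f x|)}.
  by move=> x; apply: continuous_comp (f_cont x) _; exact: norm_continuous.
have [m _ m_max] := EVT_max ler01 nf_cont.
exists (`|f m| + (\sum_i `|f (X i)| + `|schoenberg n k f 0| +
  `|schoenberg n k f 1|)) => _ [x /= x01 <-].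
apply: le_trans (ler_normB _ _) _; apply: lerD; first exact: m_max.
have S0 : 0 <= \sum_i `|f (X i)| by rewrite sumr_ge0.
move: x01; rewrite in_itv /= => /andP[].
rewrite le_eqVlt => /predU1P[<- _|x_gt0].
  by rewrite -addrA addrCA lerDl addr_ge0.
rewrite le_eqVlt => /predU1P[->|x_lt1].
  by rewrite lerDr addr_ge0.
have x01 : 0 < x < 1 by rewrite x_gt0.
rewrite schoenbergE // -addrA ler_wpDr ?addr_ge0 //.
apply: le_trans (ler_norm_sum _ _ _) _; apply: ler_sum => i _.
rewrite normrM (ger0_norm (bspline_ge0 _ x01)) ler_piMr //.
rewrite -(bspline_partition x01) (bigD1 i) //= lerDl sumr_ge0 // => j _.
exact: bspline_ge0.
Qed.
End Schoenberg.

(** * The modulus of smoothness and the lower estimate *)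

Lemma omega2_le (R : realType) (f : R -> R) (t C : R) : 0 < t -> t <= 2^-1 ->
  (forall x h, 0 <= x -> 0 < h -> x + 2 * h <= 1 ->
    `|f x - 2 * f (x + h) + f (x + 2 * h)| <= C) ->
  omega2 f t <= C.
Proof.
move=> t_gt0 t_le fC; apply: ge_sup.
  (* [ge_sup] asks for nonempty sets: [h = t / 2] serves the outer one and [x = 0] the inner one. *)
  exists (sup [set `|f x - 2 * f (x + t / 2) + f (x + 2 * (t / 2))|
    | x in `[0, 1 - 2 * (t / 2)]]); exists (t / 2) => //=.
  by rewrite in_itv /=; apply/andP; split; lra.
move=> _ [h /= + <-]; rewrite in_itv /= => /andP[h0 ht]; apply: ge_sup.
  exists `|f 0 - 2 * f (0 + h) + f (0 + 2 * h)|; exists 0 => //=.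
  by rewrite in_itv /=; apply/andP; split; lra.
move=> _ [x /= + <-]; rewrite in_itv /= => /andP[x0 xh].
by apply: fC => //; lra.
Qed.

Unset Implicit Arguments.

Theorem theorem4 (R : realType) (n k : nat) (hn : (1 <= n)%N) (hk : (3 <= k)%N) :
  exists M : R, 0 < M /\
    forall f : R -> R, {within `[0, 1], continuous f} ->
    forall t : R, 0 < t -> t <= 2^-1 ->
      M * omega2 f t <= sup_norm01 (fun x => f x - schoenberg n k f x).
Proof.
have [c c0 defect] := norm_le_defect (@schoenberg_node01 R n k hn hk)
  (bspline_ge0 hn hk) (bspline_partition hn hk)
  (bspline_reproduces_id hn hk) (bspline_spread hn hk).
(* The 4 is the sum 1 + 2 + 1 of the absolute coefficients of a second difference. *)
exists (4 * c)^-1; split=> [|f f_cont t t_gt0 t_le].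
  by rewrite invr_gt0 mulr_gt0.
rewrite mulrC ler_pdivrMr ?mulr_gt0 // mulrC.
apply: omega2_le => // x h x_ge0 h_gt0 xh.
(* [defect] wants a strict bound while the supremum gives a weak one; the slack [e / (4 * c)] below
   adds up to exactly [e]. *)
apply/ler_addgt0Pr => e e_gt0.
set N := sup_norm01 _.
pose l y := f 0 + (f 1 - f 0) * y.
have F_le y : 0 <= y <= 1 -> `|f y - l y| <= c * (N + e / (4 * c)).
  apply: (defect (fun y => f y - l y)); rewrite /l ?mulr0 ?addr0 ?subrr //.
    by lra.
  move=> z z01; have [z0 z1] := andP z01.
  have -> : f z - (f 0 + (f 1 - f 0) * z) -
      \sum_(i < n + k) (f (schoenberg_node R n k (i%:Z - k%:Z)) -
        (f 0 + (f 1 - f 0) * schoenberg_node R n k (i%:Z - k%:Z))) *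
          bspline n k (i%:Z - k%:Z) z = f z - schoenberg n k f z.
    rewrite schoenbergE //.
    rewrite (eq_bigr (fun i : 'I_(n + k) =>
        f (schoenberg_node R n k (i%:Z - k%:Z)) *
          bspline n k (i%:Z - k%:Z) z -
        (f 0 * bspline n k (i%:Z - k%:Z) z + (f 1 - f 0) *
          (schoenberg_node R n k (i%:Z - k%:Z) *
            bspline n k (i%:Z - k%:Z) z)))); last by move=> i _; ring.
    rewrite sumrB big_split /= -!mulr_sumr bspline_partition //.
    by rewrite bspline_reproduces_id //; ring.
  apply: (@le_lt_trans _ _ N); last by rewrite ltrDl divr_gt0 ?mulr_gt0.
  apply: ub_le_sup; first exact: schoenberg_defect_bounded.
  by exists z => //=; rewrite in_itv /= !ltW.
have -> : 4 * c * N + e = 4 * (c * (N + e / (4 * c))).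
  by field; apply: lt0r_neq0.
have -> : f x - 2 * f (x + h) + f (x + 2 * h) = (f x - l x) -
    2 * (f (x + h) - l (x + h)) + (f (x + 2 * h) - l (x + 2 * h)).
  by rewrite /l; ring.
set K := c * _ in F_le *.
have H0 : `|f x - l x| <= K by apply: F_le; lra.
have H1 : `|f (x + h) - l (x + h)| <= K by apply: F_le; lra.
have H2 : `|f (x + 2 * h) - l (x + 2 * h)| <= K by apply: F_le; lra.
move: H0 H1 H2; rewrite !ler_norml => /andP[? ?] /andP[? ?] /andP[? ?].
by apply/andP; split; lra.
Qed.
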